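(* Let $c\colon X\rightsquigarrow Y$ be a channel, let $\omega\in\mathcal{D}(X)$, and let $\psi\in\mathcal{M}[K](Y)$ be a multiset of size $K$. Suppose that $\omega\models \mathrm{mn}[K](c)^*\mathbf{1}_\psi$ is non-zero, so that the update below is defined. Then \[ \big(\mathrm{mn}[K](c)_*\omega\big)(\psi)=\omega\models \mathrm{mn}[K](c)^*\mathbf{1}_\psi\;\leq\;\omega|_{\mathrm{mn}[K](c)^*\mathbf{1}_\psi}\models \mathrm{mn}[K](c)^*\mathbf{1}_\psi=\big(\mathrm{mn}[K](c)_*\,\omega|_{\mathrm{mn}[K](c)^*\mathbf{1}_\psi}\big)(\psi). \] Moreover, the updated distribution satisfies $\omega|_{\mathrm{mn}[K](c)^*\mathbf{1}_\psi}=\mathrm{mn}[K](c)^\dagger_\omega(\psi)\in\mathcal{D}(X)$. Writing $\mathrm{supp}(\psi)=\{y_1,\dots,y_n\}$, it also satisfies \[ \omega|_{\mathrm{mn}[K](c)^*\mathbf{1}_\psi}=\omega|_{\&_{y\in Y}(c^*\mathbf{1}_y)^{\psi(y)}}=\omega|_{(c^*\mathbf{1}_{y_1})^{\psi(y_1)}\&\cdots\&(c^*\mathbf{1}_{y_n})^{\psi(y_n)}}. \] This equals the result of successively conditioning $\omega$ on $c^*\mathbf{1}_{y_1}$ a total of $\psi(y_1)$ times, and so on, up to conditioning on $c^*\mathbf{1}_{y_n}$ a total of $\psi(y_n)$ times.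
   Context: Distributions and multisets. \begin{itemize} \item $\mathcal{D}(X)$ denotes finitely supported probability distributions on $X$. \item $\mathcal{M}[K](Y)$ denotes multisets $\varphi\colon Y\to\mathbb{N}$ (finite support) of size $\sum_y\varphi(y)=K$. \item For $\rho\in\mathcal{D}(Y)$, the multinomial distribution on $\mathcal{M}[K](Y)$ is \[ \mathrm{mn}[K](\rho)(\varphi)=\frac{K!}{\prod_y\varphi(y)!}\prod_y\rho(y)^{\varphi(y)}. \] \end{itemize} Channels. \begin{itemize} \item A channel $c\colon X\rightsquigarrow Y$ is a function $X\to\mathcal{D}(Y)$. \item $\mathrm{mn}[K](c)\colon X\rightsquigarrow\mathcal{M}[K](Y)$ is the channel $x\mapsto\mathrm{mn}[K](c(x))$. \item The pushforward is $(c_*\omega)(y)=\sum_x\omega(x)c(x)(y)$. \end{itemize} Predicates. \begin{itemize} \item A predicate on $X$ is a function $p\colon X\to[0,1]$. \item $\mathbf{1}_y$ is the point predicate: $1$ at $y$ and $0$ elsewhere. \item The pullback of a predicate $q$ on $Y$ is $(c^*q)(x)=\sum_y c(x)(y)q(y)$. \item Conjunction $p_1\&p_2$ is pointwise multiplication, and $p^n$ is the $n$-fold conjunction of $p$ with itself. \item Validity is $\omega\models p=\sum_x\omega(x)p(x)$. \item Conditioning, defined when $\omega\models p\neq 0$, is $\omega|_p(x)=\omega(x)p(x)/(\omega\models p)$. \end{itemize} Dagger. The dagger (Bayesian inversion) of a channel $d\colon X\rightsquigarrow Z$ with respect to $\omega$ is the channel $d^\dagger_\omega\colon Z\rightsquigarrow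 X$ with $d^\dagger_\omega(z)=\omega|_{d^*\mathbf{1}_z}$, i.e. \[ d^\dagger_\omega(z)(x)=\frac{\omega(x)\,d(x)(z)}{(d_*\omega)(z)}. \] *)

(* Defs.v *)
From HB Require Import structures.
From mathcomp Require Import all_boot all_order all_algebra finmap multiset.
From mathcomp Require Import boolp classical_sets functions cardinality fsbigop reals.

Set Implicit Arguments.
Unset Strict Implicit.
Unset Printing Implicit Defensive.
Import Order.TTheory GRing.Theory Num.Theory.

Local Open Scope classical_set_scope.
Local Open Scope ring_scope.

(* The sums [\sum_(x \in [set: X]) f x] below are sums of finitely supported
   functions (fsbigop); they would default to 0 on an infinite support. *)

Record distr (R : realType) (X : choiceType) := Distr {
  dval :> X -> R;
  distr_ge0 : forall x, 0 <= dval x;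
  distr_fin : finite_set [set x | dval x != 0];
  distr_sum : \sum_(x \in [set: X]) dval x = 1 }.

Record predicate (R : realType) (X : Type) := Predicate {
  pval :> X -> R;
  predicate_itv : forall x, 0 <= pval x <= 1 }.

Definition channel (R : realType) (X Y : choiceType) := X -> distr R Y.

Record msetK (K : nat) (Y : choiceType) := MsetK {
  mval :> {mset Y}%mset;
  msetK_size : (\sum_(y <- finsupp mval) mval y)%N == K }.

HB.instance Definition _ K Y := [isSub for @mval K Y].
HB.instance Definition _ K Y := [Choice of msetK K Y by <:].

Section Distributions.
Context {R : realType}.
Implicit Types X Y Z : choiceType.

Lemma distr_eqP X (w v : distr R X) : w =1 v -> w = v.
Proof.
case: w v => [f f0 ff f1] [g g0 gf g1] /= /funext fg.
by case: _ / fg in g0 gf g1 *; congr Distr; exact: Prop_irrelevance.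
Qed.

Lemma predicate_eqP X (p q : predicate R X) : p =1 q -> p = q.
Proof.
case: p q => [f f0] [g g0] /= /funext fg.
by case: _ / fg in g0 *; congr Predicate; exact: Prop_irrelevance.
Qed.

Definition dsupp X (w : distr R X) : {fset X} := fset_set [set x | w x != 0].

Lemma in_dsupp X (w : distr R X) x : (x \in dsupp w) = (w x != 0).
Proof.
rewrite /dsupp in_fset_set; last exact: distr_fin.
by apply/idP/idP; rewrite inE.
Qed.

Lemma dsuppN X (w : distr R X) x : x \notin dsupp w -> w x = 0.
Proof. by rewrite in_dsupp negbK => /eqP. Qed.

Lemma dsumE X (w : distr R X) (g : X -> R) :
  \sum_(x \in [set: X]) w x * g x = \sum_(x <- dsupp w) w x * g x.
Proof. by apply: fsbigTE => x /dsuppN ->; rewrite mul0r. Qed.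

Lemma dsum1 X (w : distr R X) : \sum_(x <- dsupp w) w x = 1.
Proof. by rewrite -(distr_sum w); apply/esym/fsbigTE => x /dsuppN. Qed.

Lemma dsum1_sub X (w : distr R X) (A : {fset X}) :
  {subset dsupp w <= A} -> \sum_(x <- A) w x = 1.
Proof.
move=> sA; rewrite -(distr_sum w); apply/esym/fsbigTE => x xA.
by apply: dsuppN; apply: contra xA; exact: sA.
Qed.

Definition validity X (w : distr R X) (p : predicate R X) : R :=
  \sum_(x \in [set: X]) w x * p x.

(* w|_p, defined only when w |= p is nonzero *)
Section Update.
Context {X : choiceType} (w : distr R X) (p : predicate R X).
Context (h : validity w p != 0).

Definition update_val (x : X) : R := w x * p x / validity w p.

Lemma validity_ge0 : 0 <= validity w p.
Proof.
rewrite /validity dsumE; apply: sumr_ge0 => x _; apply: mulr_ge0.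
  exact: distr_ge0.
by case/andP: (predicate_itv p x).
Qed.

Lemma update_ge0 x : 0 <= update_val x.
Proof.
apply: divr_ge0; last exact: validity_ge0.
by apply: mulr_ge0; [exact: distr_ge0|case/andP: (predicate_itv p x)].
Qed.

Lemma update_fin : finite_set [set x | update_val x != 0].
Proof.
apply: sub_finite_set (distr_fin w) => x /=.
by apply: contra => /eqP wx; rewrite /update_val wx !mul0r.
Qed.

Lemma update_sum : \sum_(x \in [set: X]) update_val x = 1.
Proof.
rewrite (fsbigTE (dsupp w)); last first.
  by move=> x /dsuppN wx; rewrite /update_val wx !mul0r.
by rewrite -mulr_suml -dsumE -/(validity w p) divff.
Qed.

Definition update : distr R X := Distr update_ge0 update_fin update_sum.
End Update.

Definition oupdate X (w : distr R X) (p : predicate R X) : option (distr R X) :=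
  if boolP (validity w p != 0) is AltTrue h then Some (update h) else None.

Definition oupdates X (w : distr R X) (ps : seq (predicate R X)) :
    option (distr R X) :=
  foldl (fun o p => obind (fun v => oupdate v p) o) (Some w) ps.

Section Push.
Context {X Y : choiceType} (c : channel R X Y) (w : distr R X).

Definition push_val (y : Y) : R := \sum_(x \in [set: X]) w x * c x y.

Lemma push_ge0 y : 0 <= push_val y.
Proof.
rewrite /push_val dsumE; apply: sumr_ge0 => x _.
by apply: mulr_ge0; exact: distr_ge0.
Qed.

Let A : {fset Y} := (\bigcup_(x <- dsupp w) dsupp (c x))%fset.

Let sA x : x \in dsupp w -> {subset dsupp (c x) <= A}.
Proof. by move=> xw y yc; apply/bigfcupP; exists x; rewrite ?xw. Qed.

Let pushN y : y \notin A -> push_val y = 0.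
Proof.
move=> yA; rewrite /push_val dsumE big_seq big1// => x xw.
by rewrite (@dsuppN _ (c x)) ?mulr0//; apply: contra yA; exact: sA.
Qed.

Lemma push_fin : finite_set [set y | push_val y != 0].
Proof.
apply: (finite_subfset A) => y /=.
by apply: contraTT => yA; rewrite negbK pushN.
Qed.

Lemma push_sum : \sum_(y \in [set: Y]) push_val y = 1.
Proof.
rewrite (fsbigTE A)//.
under eq_bigr do rewrite /push_val dsumE.
rewrite exchange_big/= -[RHS](dsum1 w) big_seq [RHS]big_seq.
apply: eq_bigr => x xw.
by rewrite -mulr_sumr dsum1_sub ?mulr1//; exact: sA.
Qed.

Definition push : distr R Y := Distr push_ge0 push_fin push_sum.
End Push.

(* d^dagger_w(z), defined only when (d_*w)(z) is nonzero. *)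
Section Dagger.
Context {X Z : choiceType} (d : channel R X Z) (w : distr R X) (z : Z).
Context (h : push d w z != 0).

Definition dagger_val (x : X) : R := w x * d x z / push d w z.

Lemma dagger_ge0 x : 0 <= dagger_val x.
Proof. by apply: divr_ge0; [apply: mulr_ge0|]; exact: distr_ge0. Qed.

Lemma dagger_fin : finite_set [set x | dagger_val x != 0].
Proof.
apply: sub_finite_set (distr_fin w) => x /=.
by apply: contra => /eqP wx; rewrite /dagger_val wx !mul0r.
Qed.

Lemma dagger_sum : \sum_(x \in [set: X]) dagger_val x = 1.
Proof.
rewrite (fsbigTE (dsupp w)); last first.
  by move=> x /dsuppN wx; rewrite /dagger_val wx !mul0r.
by rewrite -mulr_suml -dsumE divff.
Qed.

Definition dagger_at : distr R X := Distr dagger_ge0 dagger_fin dagger_sum.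
End Dagger.

Definition dagger X Z (d : channel R X Z) (w : distr R X) (z : Z) :
    option (distr R X) :=
  if boolP (push d w z != 0) is AltTrue h then Some (dagger_at h) else None.

Section Pullback.
Context {X Y : choiceType} (c : channel R X Y) (q : predicate R Y).

Definition pullback_val (x : X) : R := \sum_(y \in [set: Y]) c x y * q y.

Lemma pullback_itv x : 0 <= pullback_val x <= 1.
Proof.
rewrite /pullback_val dsumE; apply/andP; split.
  apply: sumr_ge0 => y _; apply: mulr_ge0; first exact: distr_ge0.
  by case/andP: (predicate_itv q y).
rewrite -[leRHS](dsum1 (c x)); apply: ler_sum => y _.
by apply: ler_piMr; [exact: distr_ge0|case/andP: (predicate_itv q y)].
Qed.

Definition pullback : predicate R X := Predicate pullback_itv.
End Pullback.

Lemma point_itv X (y x : X) : 0 <= ((x == y)%:R : R) <= 1.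
Proof. by case: eqP; rewrite lexx ler01. Qed.

Definition pointp X (y : X) : predicate R X := Predicate (point_itv y).

Lemma truth_itv X (x : X) : 0 <= (1 : R) <= 1.
Proof. by rewrite ler01 lexx. Qed.

Definition truep X : predicate R X := Predicate (@truth_itv X).

Lemma conj_itv X (p q : predicate R X) x : 0 <= p x * q x <= 1.
Proof.
have /andP[p0 p1] := predicate_itv p x; have /andP[q0 q1] := predicate_itv q x.
by rewrite mulr_ge0//= mulr_ile1.
Qed.

Definition conjp X (p q : predicate R X) : predicate R X :=
  Predicate (conj_itv p q).

Definition powp X (p : predicate R X) (n : nat) : predicate R X :=
  iterop n (@conjp X) p (truep X).

Lemma conjA X : associative (@conjp X).
Proof. by move=> p q r; apply: predicate_eqP => x /=; rewrite mulrA. Qed.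

Lemma conjC X : commutative (@conjp X).
Proof. by move=> p q; apply: predicate_eqP => x /=; rewrite mulrC. Qed.

Lemma conj1p X : left_id (truep X) (@conjp X).
Proof. by move=> p; apply: predicate_eqP => x /=; rewrite mul1r. Qed.

HB.instance Definition _ X :=
  Monoid.isComLaw.Build (predicate R X) (truep X) (@conjp X)
    (@conjA X) (@conjC X) (@conj1p X).

Section Multinomial.
Context {Y : choiceType} (rho : distr R Y).
Implicit Types phi : {mset Y}%mset.
Local Open Scope mset_scope.

Definition multinomial (K : nat) phi : R :=
  K`!%:R / (\prod_(y <- finsupp phi) (phi y)`!)%N%:R
    * \prod_(y <- finsupp phi) rho y ^+ phi y.

Lemma finsuppN phi y : y \notin finsupp phi -> phi y = 0%N.
Proof. exact: fsfun_dflt. Qed.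

Lemma big_finsupp_widen (T : Type) (idx : T) (op : Monoid.com_law idx)
    (S : {fset Y}) phi (F : Y -> T) :
  {subset finsupp phi <= S} -> (forall y, phi y = 0%N -> F y = idx) ->
  \big[op/idx]_(y <- finsupp phi) F y = \big[op/idx]_(y <- S) F y.
Proof.
move=> sS F0; rewrite -(fsbigTE (finsupp phi)); last first.
  by move=> y /finsuppN /F0.
by apply: fsbigTE => y yS; apply/F0/finsuppN; apply: contra yS => /sS.
Qed.

Lemma multinomialE (S : {fset Y}) K phi : {subset finsupp phi <= S} ->
  multinomial K phi =
  K`!%:R / (\prod_(y <- S) (phi y)`!)%N%:R * \prod_(y <- S) rho y ^+ phi y.
Proof.
move=> sS; rewrite /multinomial.
rewrite (big_finsupp_widen _ sS); last by move=> y ->.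
by rewrite (big_finsupp_widen _ sS)// => y ->; rewrite expr0.
Qed.

Lemma msizeE (S : {fset Y}) phi : {subset finsupp phi <= S} ->
  (\sum_(y <- finsupp phi) phi y)%N = (\sum_(y <- S) phi y)%N.
Proof. by move=> sS; rewrite (big_finsupp_widen _ sS). Qed.

Lemma finsuppB1 phi y (S : {fset Y}) :
  {subset finsupp phi <= S} -> {subset finsupp (phi `\ y) <= S}.
Proof.
move=> sS z; rewrite mem_finsupp msetB1E => z0; apply: sS.
by rewrite mem_finsupp; apply: contra z0 => /eqP ->.
Qed.

Lemma msizeB1 phi y K : y \in phi ->
  (\sum_(z <- finsupp phi) phi z)%N = K.+1 ->
  (\sum_(z <- finsupp (phi `\ y)) (phi `\ y) z)%N = K.
Proof.
move=> yp; have yS : y \in finsupp phi by rewrite msuppE.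
rewrite (msizeE (finsuppB1 (y := y) (fun=> id))) !(big_fsetD1 y yS)/=.
have -> : (\sum_(i <- (finsupp phi `\ y)%fset) (phi `\ y) i =
           \sum_(i <- (finsupp phi `\ y)%fset) phi i)%N.
  apply: eq_big_seq => i.
  by rewrite !inE msetB1E => /andP[/negPf -> _]; rewrite subn0.
have : (0 < phi y)%N by rewrite mset_gt0.
by rewrite msetB1E eqxx; case: (phi y) => // n _; rewrite subn1 /= addSn => -[].
Qed.

Lemma multinomial_rec (S : {fset Y}) K phi : {subset finsupp phi <= S} ->
  (\sum_(y <- finsupp phi) phi y)%N = K.+1 ->
  multinomial K.+1 phi =
  \sum_(y <- S | y \in phi) rho y * multinomial K (phi `\ y).
Proof.
move=> sS szK.
pose F : R := (\prod_(y <- S) (phi y)`!)%N%:R.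
pose P : R := \prod_(y <- S) rho y ^+ phi y.
have yE y : y \in S -> (if y \in phi then rho y * multinomial K (phi `\ y) else 0)
    = (phi y)%:R * (K`!%:R / F * P).
  move=> yS; case: ifPn => [yp|]; last first.
    by rewrite -mset_eq0 => /eqP ->; rewrite mul0r.
  rewrite (multinomialE _ (finsuppB1 (y := y) sS)).
  have p0 : (0 < phi y)%N by rewrite mset_gt0.
  rewrite /F /P !(big_fsetD1 y yS)/=.
  rewrite !msetB1E eqxx.
  have E1 : (\prod_(i <- (S `\ y)%fset) ((phi `\ y) i)`!)%N =
            (\prod_(i <- (S `\ y)%fset) (phi i)`!)%N.
    rewrite big_seq [RHS]big_seq; apply: eq_bigr => i.
    by rewrite !inE msetB1E => /andP[/negPf -> _]; rewrite subn0.
  have E2 : \prod_(i <- (S `\ y)%fset) rho i ^+ ((phi `\ y) i) =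
            \prod_(i <- (S `\ y)%fset) rho i ^+ (phi i).
    rewrite big_seq [RHS]big_seq; apply: eq_bigr => i.
    by rewrite !inE msetB1E => /andP[/negPf -> _]; rewrite subn0.
  rewrite E1 E2; case: (phi y) p0 => // n _.
  rewrite subn1 /= factS exprS !natrM.
  set a := (\prod_(i <- _) _)%N%:R; set b := \prod_(i <- _) _.
  have n0 : n.+1%:R != 0 :> R by rewrite pnatr_eq0.
  rewrite !invfM -!mulrA [RHS]mulrCA mulVKf//.
  by do 3![rewrite [LHS]mulrCA; congr (_ * _)].
rewrite big_mkcond big_seq (eq_bigr _ yE) -big_seq -mulr_suml -natr_sum.
rewrite -(msizeE sS) szK (multinomialE _ sS) factS natrM -/F -/P.
by rewrite !mulrA.
Qed.

Fixpoint msets (S : {fset Y}) (K : nat) : {fset {mset Y}} :=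
  if K is K'.+1 then [fset (y +` phi) | y in S, phi in msets S K']%fset
  else [fset mset0]%fset.

Lemma msetsP S K phi : reflect
  ({subset finsupp phi <= S} /\ (\sum_(y <- finsupp phi) phi y)%N = K)
  (phi \in msets S K).
Proof.
elim: K phi => [|K IH] phi /=.
  rewrite inE; apply: (iffP eqP) => [->|[_ /eqP]].
    by rewrite finsupp0 big_seq_fset0; split.
  rewrite sum_nat_seq_eq0 => /allP p0; apply/msetP => y; rewrite mset0E.
  by case: (boolP (y \in finsupp phi)) => [/p0 /eqP|/finsuppN].
apply: (iffP (imfset2P _ _ _ _ _)) => /= [[y yS [psi /IH[sS szK] ->]]|[sS szK]].
  have sS' : {subset finsupp (y +` psi) <= S}.
    move=> z; rewrite mem_finsupp mset1DE; case: (eqVneq z y) => [->//|_].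
    by rewrite add0n => pz; apply: sS; rewrite mem_finsupp.
  split=> //; rewrite (msizeE sS') (big_fsetD1 y yS)/= mset1DE eqxx.
  rewrite -{}szK (msizeE sS) (big_fsetD1 y yS)/= -addnA add1n; congr (_ + _).+1.
  rewrite big_seq [RHS]big_seq; apply: eq_bigr => i.
  by rewrite !inE mset1DE => /andP[/negPf -> _].
have [y yp] : exists y, y \in phi.
  case: (mset_0Vmem phi) => [p0|[y yp]]; last by exists y.
  by move: szK; rewrite p0 finsupp0 big_seq_fset0.
have yS : y \in S by apply: sS; rewrite msuppE.
exists y => //; exists (phi `\ y); last by rewrite msetB1K.
apply/IH; split; first exact: finsuppB1.
exact: msizeB1.
Qed.

Lemma multinomial_sum1 K : \sum_(phi <- msets (dsupp rho) K) multinomial K phi = 1.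
Proof.
set S := dsupp rho; elim: K => [|K IH].
  rewrite /= big_seq_fset1 /multinomial finsupp0 !big_seq_fset0.
  by rewrite fact0 divr1 mulr1.
transitivity (\sum_(phi <- msets S K.+1)
    \sum_(y <- S | y \in (phi : {mset Y})) rho y * multinomial K (phi `\ y)).
  rewrite big_seq [RHS]big_seq; apply: eq_bigr => phi /msetsP[sS szK].
  exact: multinomial_rec.
rewrite (exchange_big_dep predT)//= -[RHS](dsum1 rho) big_seq [RHS]big_seq.
apply: eq_bigr => y yS; rewrite -mulr_sumr -[RHS]mulr1; congr (_ * _).
rewrite -[RHS]IH -[LHS]big_filter.
transitivity (\sum_(phi <- msets S K) multinomial K ((y +` phi) `\ y)); last first.
  by apply: eq_bigr => phi _; rewrite msetD1K.
rewrite -(big_map (msetD (msetn 1 y)) predT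
  (fun phi => multinomial K (phi `\ y))).
apply: perm_big; apply: uniq_perm.
- exact/filter_uniq/fset_uniq.
- by rewrite map_inj_uniq ?fset_uniq//; exact: can_inj (msetDKB _).
move=> phi; rewrite mem_filter; apply/andP/mapP.
- move=> [yp phiK]; have /msetsP[sS szK] : phi \in msets S K.+1 := phiK.
  exists (phi `\ y); last by rewrite msetB1K.
  apply/msetsP; split; first exact: finsuppB1.
  exact: msizeB1.
- move=> [psi psiK ->]; split; first exact: mset1D1.
  by apply/(imfset2P _ _ _ _ _); exists y => //; exists psi.
Qed.

Context (K : nat).

Definition mn_val (phi : msetK K Y) : R := multinomial K phi.

Lemma mn_ge0 psi : 0 <= mn_val psi.
Proof.
apply: mulr_ge0; first by rewrite divr_ge0.
by apply: prodr_ge0 => y _; apply/exprn_ge0/distr_ge0.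
Qed.

Let mn_supp (psi : msetK K Y) :
  mn_val psi != 0 -> mval psi \in msets (dsupp rho) K.
Proof.
move=> nz; apply/msetsP; split; last exact/eqP/msetK_size.
move=> y yp; rewrite in_dsupp; apply: contra nz => /eqP ry.
rewrite /mn_val /multinomial [X in _ * X](big_fsetD1 y yp)/= ry expr0n.
by move: yp; rewrite mem_finsupp => /negPf ->; rewrite mul0r mulr0.
Qed.

Lemma mn_fin : finite_set [set psi | mn_val psi != 0].
Proof.
apply: (@sub_finite_set _ _ (@mval K Y @^-1` [set` msets (dsupp rho) K])).
  by move=> psi /= /mn_supp.
by apply: finite_preimage (finite_fset _) => psi chi _ _; exact: val_inj.
Qed.

Lemma mn_sum : \sum_(psi \in [set: msetK K Y]) mn_val psi = 1.
Proof.
rewrite -(multinomial_sum1 K).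
rewrite [RHS]fsbig_seq ?fset_uniq//.
have bij : set_bij (@mval K Y @^-1` [set` msets (dsupp rho) K])
    [set` msets (dsupp rho) K] (@mval K Y).
  split=> // [psi chi _ _ /val_inj//|phi /= phiS].
  by have /msetsP[_ /eqP szK] := phiS; exists (MsetK szK).
transitivity (\sum_(psi \in @mval K Y @^-1` [set` msets (dsupp rho) K]) mn_val psi).
  apply/esym/fsbig_widen => // psi [_ /= nS].
  by apply/eqP/negPn/negP => nz; exact/nS/mn_supp.
by apply/esym; exact: reindex_fsbig bij.
Qed.

Definition mn : distr R (msetK K Y) := Distr mn_ge0 mn_fin mn_sum.

End Multinomial.

Definition mnc (K : nat) X Y (c : channel R X Y) : channel R X (msetK K Y) :=
  fun x => mn (c x) K.
End Distributions.

(* Main.v *)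
(** The likelihood of [psi] at [x] is [mn[K](c x)(psi) = C * \prod_y (c x y) ^ psi y]
    with the multinomial coefficient [C] independent of [x], and conditioning
    ignores nonzero constant factors. Conditioning on a conjunction is
    successive conditioning, since [w |= p & q = (w |= p) * (w|_p |= q)].
    The inequality says that [p] has nonnegative variance under [w]. *)

Require Import Defs.
From mathcomp Require Import all_boot all_order all_algebra finmap multiset.
From mathcomp Require Import boolp classical_sets functions cardinality fsbigop.
From mathcomp Require Import reals.
Import Order.TTheory GRing.Theory Num.Theory.
Local Open Scope classical_set_scope.
Local Open Scope ring_scope.

Set Implicit Arguments.
Unset Strict Implicit.
Unset Printing Implicit Defensive.

Section Conditioning.
Context {R : realType}.
Implicit Types X Y Z : choiceType.

Lemma powpE X (p : predicate R X) n x : powp p n x = p x ^+ n.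
Proof.
rewrite /powp; case: n => [|n]; first by rewrite expr0.
(* [iterop] makes the first power [p] itself, so the induction starts at exponent one. *)
by rewrite iteropS; elim: n => [|n IHn]; rewrite ?expr1 // exprS -IHn.
Qed.

(** Evaluation at [x] is a monoid morphism from conjunction to multiplication. *)
Lemma big_conjpE X (I : Type) (s : seq I) (F : I -> predicate R X) x :
  (\big[@conjp R X/@truep R X]_(i <- s) F i) x = \prod_(i <- s) F i x.
Proof. exact: (big_morph (fun p : predicate R X => p x)). Qed.

Lemma pullback_pointE X Y (c : channel R X Y) y x :
  pullback c (pointp y) x = c x y.
Proof.
rewrite /= /pullback_val (fsbigTE [fset y]%fset).
  by rewrite big_seq_fset1 /= eqxx mulr1.
by move=> z; rewrite inE /= => /negPf ->; rewrite mulr0.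
Qed.

Lemma validity_pullback_point X Z (d : channel R X Z) (w : distr R X) z :
  validity w (pullback d (pointp z)) = push d w z.
Proof.
rewrite /validity -[RHS]/(push_val d w z); apply: eq_fsbigr => x _.
by rewrite pullback_pointE.
Qed.

Lemma validity_truep X (w : distr R X) : validity w (truep X) = 1.
Proof. by rewrite /validity dsumE /= -mulr_suml dsum1 mul1r. Qed.

Lemma validityZ X (w : distr R X) (p q : predicate R X) k :
  (forall x, p x = k * q x) -> validity w p = k * validity w q.
Proof.
move=> pq; rewrite /validity !dsumE mulr_sumr.
by apply: eq_bigr => x _; rewrite pq mulrCA.
Qed.

Lemma validity_update X (w : distr R X) (p q : predicate R X)
    (h : validity w p != 0) :
  validity (update h) q = validity w (conjp p q) / validity w p.
Proof.
rewrite {1}/validity (fsbigTE (dsupp w)) /=; last first.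
  by move=> x /dsuppN wx; rewrite /update_val wx !mul0r.
rewrite [X in X / _]/validity dsumE mulr_suml; apply: eq_bigr => x _.
by rewrite /update_val /= !mulrA mulrAC.
Qed.

(** The right side minus the left is the variance of [p], a weighted sum of squares. *)
Lemma validity_sqr_le X (w : distr R X) (p : predicate R X) :
  validity w p ^+ 2 <= validity w (conjp p p).
Proof.
set v := validity w p.
have : 0 <= \sum_(x <- dsupp w) w x * (p x - v) ^+ 2.
  by apply: sumr_ge0 => x _; rewrite mulr_ge0 ?distr_ge0 ?sqr_ge0.
suff -> : \sum_(x <- dsupp w) w x * (p x - v) ^+ 2 =
    validity w (conjp p p) - v ^+ 2 by rewrite subr_ge0.
transitivity (\sum_(x <- dsupp w) (w x * (p x * p x) - (w x * p x) * (v *+ 2)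
    + w x * v ^+ 2)).
  apply: eq_bigr => x _; rewrite sqrrB [p x ^+ 2]expr2 mulrDr mulrBr.
  by rewrite -[p x * v *+ 2]mulrnAr -[w x * p x * _]mulrA.
(* The mass 1 of [w] turns the last sum into [v ^+ 2], and the cross term is twice [v ^+ 2]. *)
rewrite big_split sumrB /= -!mulr_suml dsum1 mul1r.
rewrite -[X in X * (v *+ 2)]dsumE -/(validity w p) -/v /validity dsumE /=.
by rewrite mulrnAr -expr2 mulr2n opprD addrA addrNK.
Qed.

(** Multiplying by the positive [validity w p] leaves the variance inequality. *)
Lemma validity_le_update X (w : distr R X) (p : predicate R X)
    (h : validity w p != 0) : validity w p <= validity (update h) p.
Proof.
rewrite validity_update ler_pdivlMr ?lt_def ?h ?validity_ge0//.
by rewrite -expr2 validity_sqr_le.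
Qed.

Lemma oupdate_some X (w v : distr R X) (p : predicate R X) :
  validity w p != 0 -> (forall x, w x * p x / validity w p = v x) ->
  oupdate w p = Some v.
Proof.
move=> h wv; rewrite /oupdate; case: {-}_ / boolP => [h'|]; last by rewrite h.
by congr Some; apply: distr_eqP => x; exact: wv.
Qed.

Lemma oupdate_none X (w : distr R X) (p : predicate R X) :
  validity w p = 0 -> oupdate w p = None.
Proof.
move=> v0; rewrite /oupdate; case: {-}_ / boolP => // h.
by have := h; rewrite v0 eqxx.
Qed.

Lemma oupdate_truep X (w : distr R X) : oupdate w (truep X) = Some w.
Proof.
by apply: oupdate_some => [|x]; rewrite validity_truep ?oner_neq0 //= mulr1 divr1.
Qed.

(** The factor [k] cancels against the normalisation. It is a real scalar because a multinomial
    coefficient may exceed 1. *)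
Lemma oupdate_scale X (w : distr R X) (p q : predicate R X) k
    (h : validity w p != 0) :
  (forall x, p x = k * q x) -> oupdate w q = Some (update h).
Proof.
move=> pq; have vE := validityZ w pq.
(* Both [k] and the validity of [q] are nonzero, being factors of the validity of [p]. *)
have := h; rewrite vE mulf_eq0 negb_or => /andP[k0 q0].
apply: oupdate_some => // x; rewrite /= /update_val vE pq invfM.
by rewrite [w x * (k * _)]mulrCA mulrACA divff// mul1r.
Qed.

(** As [q] is at most 1, conjunction with it cannot raise validity. So if conditioning on [p] is
    undefined, conditioning on the conjunction is too. *)
Lemma validity_conjp0 X (w : distr R X) (p q : predicate R X) :
  validity w p = 0 -> validity w (conjp p q) = 0.
Proof.
move=> v0; apply/eqP; rewrite eq_le validity_ge0 andbT -v0 /validity !dsumE.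
apply: ler_sum => x _; rewrite ler_wpM2l ?distr_ge0//= ler_piMr//.
  by case/andP: (predicate_itv p x).
by case/andP: (predicate_itv q x).
Qed.

(** Both sides are undefined in the same cases; otherwise the two successive normalisations multiply
    to the single one. *)
Lemma oupdate_conjp X (w : distr R X) (p q : predicate R X) :
  obind (fun v => oupdate v q) (oupdate w p) = oupdate w (conjp p q).
Proof.
have [v0|h] := eqVneq (validity w p) 0.
  by rewrite (oupdate_none v0) (oupdate_none (validity_conjp0 q v0)).
rewrite (@oupdate_some _ _ (update h) _ h)//=.
have [v0|h'] := eqVneq (validity w (conjp p q)) 0.
  by rewrite !oupdate_none// validity_update v0 mul0r.
rewrite [RHS](@oupdate_some _ _ (update h') _ h')//.
apply: oupdate_some => [|x]; first by rewrite validity_update mulf_neq0 ?invr_neq0.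
rewrite validity_update /= /update_val /= invfM invrK.
by rewrite [X in _ * X]mulrC !mulrA [_ / _ * q x]mulrAC divfK.
Qed.

(** Induction peels off the last predicate, since the left fold conditions on it last. *)
Lemma oupdatesE X (w : distr R X) (ps : seq (predicate R X)) :
  oupdates w ps = oupdate w (\big[@conjp R X/@truep R X]_(p <- ps) p).
Proof.
elim/last_ind: ps => [|ps p IH]; first by rewrite big_nil oupdate_truep.
by rewrite big_rcons /= -oupdate_conjp -IH /oupdates foldl_rcons.
Qed.

(** The two distributions have the same numerators and the same normalisation. *)
Lemma dagger_some X Z (d : channel R X Z) (w : distr R X) z
    (h : validity w (pullback d (pointp z)) != 0) :
  dagger d w z = Some (update h).
Proof.
rewrite /dagger; case: {-}_ / boolP => [h'|].
  congr Some; apply: distr_eqP => x.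
  by rewrite /= /dagger_val /update_val validity_pullback_point pullback_pointE.
by rewrite -validity_pullback_point h.
Qed.

Lemma big_conjp_flatten_nseq X (I : Type) (s : seq I) (n : I -> nat)
    (F : I -> predicate R X) :
  \big[@conjp R X/@truep R X]_(p <- flatten [seq nseq (n i) (F i) | i <- s]) p =
  \big[@conjp R X/@truep R X]_(i <- s) powp (F i) (n i).
Proof.
rewrite big_flatten big_map; apply: eq_bigr => i _.
apply: predicate_eqP => x; rewrite big_conjpE powpE big_nseq.
exact: iter_mulr_1.
Qed.

(** This is the factorisation of the likelihood in the form that [oupdate_scale] takes, with the
    multinomial coefficient as [k]. *)
Lemma mnc_pullbackE X Y K (c : channel R X Y) (psi : msetK K Y) x :
  pullback (mnc K c) (pointp psi) x =
  K`!%:R / (\prod_(y <- finsupp (mval psi)) (mval psi y)`!)%N%:R *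
  (\big[@conjp R X/@truep R X]_(y <- finsupp (mval psi))
     powp (pullback c (pointp y)) (mval psi y)) x.
Proof.
rewrite pullback_pointE big_conjpE /= /mn_val /multinomial; congr (_ * _).
by apply: eq_bigr => y _; rewrite powpE pullback_pointE.
Qed.

End Conditioning.

Theorem theorem7p3 (R : realType) (X Y : choiceType) (K : nat)
    (c : channel R X Y) (w : distr R X) (psi : msetK K Y)
    (h : validity w (pullback (mnc K c) (pointp psi)) != 0) :
  [/\ push (mnc K c) w psi = validity w (pullback (mnc K c) (pointp psi)),
      validity w (pullback (mnc K c) (pointp psi))
        <= validity (update h) (pullback (mnc K c) (pointp psi))
    & validity (update h) (pullback (mnc K c) (pointp psi))
        = push (mnc K c) (update h) psi]
  /\ dagger (mnc K c) w psi = Some (update h)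
  /\ oupdate w (\big[@conjp R X/@truep R X]_(y \in [set: Y])
                   powp (pullback c (pointp y)) (mval psi y)) = Some (update h)
  /\ forall s : seq Y, uniq s -> s =i finsupp (mval psi) ->
       oupdate w (\big[@conjp R X/@truep R X]_(y <- s)
                     powp (pullback c (pointp y)) (mval psi y)) = Some (update h)
       /\ oupdates w (flatten [seq nseq (mval psi y) (pullback c (pointp y)) | y <- s])
            = Some (update h).
Proof.
have upd : oupdate w (\big[@conjp R X/@truep R X]_(y <- finsupp (mval psi))
    powp (pullback c (pointp y)) (mval psi y)) = Some (update h).
  by apply: oupdate_scale => x; exact: mnc_pullbackE.
split; first by split; rewrite ?validity_le_update// validity_pullback_point.
split; first exact: dagger_some.
split.
  (* Off the support of [psi] the exponent is 0 and the power is the truth predicate, the unit of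
     conjunction. *)
  rewrite (fsbigTE (finsupp (mval psi)))// => y /finsuppN ->.
  exact: predicate_eqP.
(* Successive conditioning becomes the same conjunction of powers, so one reordering of [s] settles
   both claims. *)
move=> s us sE; rewrite oupdatesE big_conjp_flatten_nseq.
suff -> : \big[@conjp R X/@truep R X]_(y <- s)
    powp (pullback c (pointp y)) (mval psi y) =
  \big[@conjp R X/@truep R X]_(y <- finsupp (mval psi))
    powp (pullback c (pointp y)) (mval psi y) by [].
by apply: perm_big; apply: uniq_perm => //; exact: fset_uniq.
Qed.
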